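(* Let $q$ be a positive integer, $\Sigma_q=\{0,1,\dots,q-1\}$, and let $P\subseteq\Sigma_q^*$ be a finite set of nonempty words (blocks). Assume: (DC1) every ordered pair of distinct equal-length blocks in $P$ passes the same-length detecting test; (DC2) every ordered pair $(x,y)\in P^2$ with $|x|<|y|$ passes the two-stage detecting test (with respect to $P$). Then, for every $n\ge0$, the code $C_n(P)=P^*\cap\Sigma_q^n$ is detecting, i.e. $B(c)\cap C_n(P)=\{c\}$ for every $c\in C_n(P)$.
   Context: For $c=c_1\cdots c_n\in\Sigma_q^n$, $B(c)$ is the set of all words $z=z_1\cdots z_n$ with $z_i=c_{\pi(i)}$ for some permutation $\pi$ of $\{1,\dots,n\}$ satisfying $|\pi(i)-i|\le 1$ for all $i$; equivalently, all words obtained from $c$ by swapping the symbols in any set of pairwise disjoint pairs of adjacent positions. $\mathrm{pref}_k(w)$ is the length-$k$ prefix of $w$. For $w\in\Sigma_q^\ell$ the truncated ball is $\mathsf T(w)=\{\mathrm{pref}_{\ell-1}(w'):w'\in B(w)\}\subseteq\Sigma_q^{\ell-1}$. $P^*=\{p_1\cdots p_m:m\ge0,\ p_i\in P\}$ (including the empty word). For $d\ge0$, $\mathrm{Pref}_d(P^* )$ is the set of length-$d$ prefixes of words in $P^*$ (of length at least $d$). Same-length detecting test: for $u,v\in\Sigma_q^\ell$, the ordered pair $(u,v)$ passes if $\mathrm{pref}_{\ell-1}(v)\notin\mathsf T(u)$. Two-stage detecting test: for $x,y\in P$ with $\ell_x=|x|<\ell_y=|y|$, put $d=\ell_y-\ell_x$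 and $y_0=\mathrm{pref}_{\ell_x}(y)$. The ordered pair $(x,y)$ passes if at least one of the following holds: (S1) $\mathrm{pref}_{\ell_x-1}(y_0)\notin\mathsf T(x)$; (S2) for every $\rho\in\mathrm{Pref}_d(P^* )$, the ordered pair $(x\rho,y)$ passes the same-length detecting test, i.e. $\mathrm{pref}_{\ell_y-1}(y)\notin\mathsf T(x\rho)$. *)

(* Defs.v *)
From mathcomp Require Import all_boot all_fingroup all_algebra.
From mathcomp Require Import classical_sets cardinality.

Set Implicit Arguments.
Unset Strict Implicit.
Unset Printing Implicit Defensive.

Local Open Scope classical_set_scope.

Notation word q := (seq 'I_q).

(* [z_i = c_(s i)]; positions are numbered from 0. *)
Definition swap_ball (q : nat) (c : word q) : set (word q) :=
  [set z | exists2 s : 'S_(size c),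
     (forall i, `|s i - i| <= 1)%N
     & z = [seq tnth (in_tuple c) (s i) | i : 'I_(size c)]].

Notation pref k w := (take k w) (only parsing).

Definition truncated_ball (q : nat) (w : word q) : set (word q) :=
  [set pref (size w).-1 w' | w' in swap_ball w].

Definition kstar (q : nat) (P : set (word q)) : set (word q) :=
  [set w | exists2 ps : seq (word q),
     (forall p, p \in ps -> P p) & w = flatten ps].

(* The bound on [size w] is needed: [take d w] is [w] when [w] is too short. *)
Definition Pref (q d : nat) (L : set (word q)) : set (word q) :=
  [set pref d w | w in [set w | L w /\ (d <= size w)%N]].

(* Meaningful for words of the same length. *)
Definition same_length_test (q : nat) (u v : word q) : Prop :=
  ~ truncated_ball u (pref (size v).-1 v).

(* Meaningful for [size x < size y]. *)
Definition two_stage_test (q : nat) (P : set (word q)) (x y : word q) : Prop :=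
  let d := (size y - size x)%N in
  let y0 := pref (size x) y in
  ~ truncated_ball x (pref (size x).-1 y0) \/
  (forall rho, Pref d (kstar P) rho -> same_length_test (x ++ rho) y).

Definition code (q : nat) (P : set (word q)) (n : nat) : set (word q) :=
  kstar P `&` [set c | size c = n].

Definition detecting (q : nat) (C : set (word q)) : Prop :=
  forall c, C c -> swap_ball c `&` C = [set c].

(* Main.v *)
(** The relation [z \in B(c)] is symmetric, and a common prefix of [c] and [z]
    can be cancelled from it. So let two codewords be related, with distinct
    first blocks [x] and [y], where [size x <= size y] by symmetry. A swap
    across the boundary of a prefix [u] of the first codeword only affects the
    last letter of the corresponding prefix of the second one; hence the
    prefix of length [(size u).-1] of the second codeword lies in [T(u)]. With
    [u] the prefix of length [size x] or of length [size y], this contradicts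
    the tests. *)
Require Import Defs.
From mathcomp Require Import all_boot all_fingroup all_algebra.
From mathcomp Require Import zify.
From mathcomp Require Import classical_sets cardinality.

Set Implicit Arguments.
Unset Strict Implicit.
Unset Printing Implicit Defensive.

Local Open Scope classical_set_scope.

(** The ball read from left to right: each letter is either kept or exchanged with its right
    neighbour. Unlike permutations, this form allows induction on the words. *)
Inductive swapped (T : Type) : seq T -> seq T -> Prop :=
| swapped_nil : swapped [::] [::]
| swapped_keep a c z : swapped c z -> swapped (a :: c) (a :: z)
| swapped_swap a b c z :
    swapped c z -> swapped [:: a, b & c] [:: b, a & z].

Section Swapped.
Variable T : Type.
Implicit Types c z u v : seq T.

Lemma swapped_refl c : swapped c c.
Proof. by elim: c => [|a c IH]; constructor. Qed.

Lemma swapped_sym c z : swapped c z -> swapped z c.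
Proof. by elim=> *; constructor. Qed.

Lemma swapped_size c z : swapped c z -> size c = size z.
Proof. by elim=> //= [a|a b] {}c {}z _ ->. Qed.

(** If the first letter is swapped, the equal heads force both swapped letters to be [a], so keeping
    them gives the same words. *)
Lemma swapped_cons a c z : swapped (a :: c) (a :: z) -> swapped c z.
Proof.
move=> H; inversion H; subst => //.
exact: swapped_keep.
Qed.

Lemma swapped_cat u c z : swapped (u ++ c) (u ++ z) -> swapped c z.
Proof. by elim: u => //= a u IH /swapped_cons. Qed.

Lemma swapped_take k c z : swapped c z ->
  exists2 w, swapped (take k c) w & take k.-1 w = take k.-1 z.
Proof.
move=> H; elim: H k => [|a {}c {}z _ IH|a b {}c {}z _ IH] k.
- by exists [::] => //; constructor.
- case: k => [|k]; first by exists [::]; rewrite ?take0 //; constructor.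
  have [w cw wz] := IH k; exists (a :: w); first by constructor.
  by case: k wz {cw} => //= k ->.
case: k => [|[|k]]; first by exists [::]; rewrite ?take0 //; constructor.
  (* The cut falls inside a swap: undo it and keep [a]. The prefixes to be compared are empty. *)
  by exists [:: a]; rewrite /= ?take0 //; apply: swapped_refl.
have [w cw wz] := IH k; exists [:: b, a & w]; first by constructor.
by case: k wz {cw} => //= k ->.
Qed.

(** Nearness leaves only 0 and 1 for [f 0]. In the first case a kept letter is peeled off, in the
    second a swap; the rest of [f] and [g], shifted down, is again a near bijection. *)
Lemma swapped_of_bij x0 c z (f g : nat -> nat) :
  size z = size c ->
  (forall i, i < size c -> [/\ f i < size c, g i < size c,
     f (g i) = i & g (f i) = i])%N ->
  (forall i, i < size c -> f i <= i.+1 /\ i <= (f i).+1)%N ->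
  (forall i, i < size c -> nth x0 z i = nth x0 c (f i))%N ->
  swapped c z.
Proof.
have [n] := ubnP (size c); elim: n c z f g => // n IH [|a c] z f g.
  by move=> _ /size0nil -> *; constructor.
case: z => // a' z /= ltn [sz] bij near val.
have [_ _ fg0 gf0] := bij 0%N isT.
have [f0 _] := near 0%N isT.
have val0 := val 0%N isT.
case Ef: (f 0%N) f0 gf0 val0 => [|[|//]] _ gf0 /= val0.
  rewrite val0; apply: swapped_keep.
  (* The value 0 is already taken at 0, so the shift by one loses nothing. *)
  have fS i : (i < size c)%N -> f i.+1 = (f i.+1).-1.+1.
    move=> li; have [_ _ _ gf] := bij i.+1 li.
    by case Ei: (f i.+1) gf => //; rewrite gf0.
  have gS i : (i < size c)%N -> g i.+1 = (g i.+1).-1.+1.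
    move=> li; have [_ _ fg _] := bij i.+1 li.
    by case Ei: (g i.+1) fg => //; rewrite Ef.
  apply: (IH c z (fun i => (f i.+1).-1) (fun i => (g i.+1).-1)) => // i li.
  - have := fS i li; have := gS i li; have [bf bg fg gf] := bij i.+1 li.
    by move=> <- <-; rewrite fg gf; split=> //; lia.
  - by have := fS i li; have := near i.+1 li; lia.
  - by have := val i.+1 li; rewrite fS.
have c_gt0 : (0 < size c)%N by have [] := bij 0%N isT; rewrite Ef.
(* The preimage of 0 is at most 1 by nearness, and it is not 0 because [f 0] is 1. So [f] exchanges
   0 and 1. *)
have g0 : g 0%N = 1%N.
  have [_ lg _ _] := bij 0%N isT; have [_] := near _ lg; rewrite fg0.
  by case Eg: (g 0%N) fg0 => [|[|//]]; rewrite ?Ef.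
have f1 : f 1%N = 0%N by rewrite -g0.
have g1 : g 1%N = 0%N by [].
case: c c_gt0 ltn sz bij near val val0 => // b c _ /= ltn.
case: z => // b' z [sz] bij near val /= val0.
have /= val1 := val 1%N isT; rewrite f1 /= in val1.
rewrite val0 val1; apply: swapped_swap.
have fS i : (i < size c)%N -> f i.+2 = (f i.+2).-2.+2.
  move=> li; have [_ _ _ gf] := bij i.+2 li.
  by case Ei: (f i.+2) gf => [|[|k]] //; rewrite ?g0 ?g1.
have gS i : (i < size c)%N -> g i.+2 = (g i.+2).-2.+2.
  move=> li; have [_ _ fg _] := bij i.+2 li.
  by case Ei: (g i.+2) fg => [|[|k]] //; rewrite ?Ef ?f1.
apply: (IH c z (fun i => (f i.+2).-2) (fun i => (g i.+2).-2)) => //.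
- by lia.
- move=> i li; have := fS i li; have := gS i li.
  have [bf bg fg gf] := bij i.+2 li.
  by move=> <- <-; rewrite fg gf; split=> //; lia.
- by move=> i li; have := fS i li; have := near i.+2 li; lia.
- by move=> i li; have := val i.+2 li; rewrite fS.
Qed.

(** Disjoint transpositions compose to an involution, so no separate inverse is needed. Beyond the
    word [f] is the identity and both sides of the last equation are [x0]. *)
Lemma swapped_involution x0 c z : swapped c z ->
  exists f : nat -> nat,
  [/\ involutive f, forall i, (i < size c -> f i < size c)%N,
      forall i, (f i <= i.+1 /\ i <= (f i).+1)%N &
      forall i, nth x0 z i = nth x0 c (f i)].
Proof.
elim=> [|a {}c {}z _ [f [fK fs near val]]|a b {}c {}z _ [f [fK fs near val]]].
- by exists id; split.
- exists (fun i => if i is j.+1 then (f j).+1 else 0%N); split=> [] [|i] //=.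
  + by rewrite fK.
  + exact: fs.
  + exact: near.
exists (fun i => match i with 0 => 1 | 1 => 0 | j.+2 => (f j).+2 end)%N.
split=> [] [|[|i]] //=.
- by rewrite fK.
- exact: fs.
- exact: near.
Qed.

End Swapped.

Lemma swap_ballP (q : nat) (c z : word q) : swap_ball c z <-> swapped c z.
Proof.
(* The empty word is treated apart: [nth] needs a default letter and [inord] a nonempty range. *)
case: c => [|x0 c].
  split=> [[s _ zs]|/swapped_size/esym/size0nil ->].
    have -> : z = [::]; last by constructor.
    by apply/size0nil; rewrite zs size_map -cardE card_ord.
  exists 1%g; first by case.
  by apply/esym/size0nil; rewrite size_map -cardE card_ord.
set w := x0 :: c.
have nthw (s : 'S_(size w)) (i : 'I_(size w)) :
  nth x0 [seq tnth (in_tuple w) (s j) | j : 'I_(size w)] i = nth x0 w (s i).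
  rewrite (nth_map i) -?cardE ?card_ord // nth_ord_enum.
  by rewrite (tnth_nth x0).
split=> [[s near ->]|H].
  pose f i := s (inord i) : nat; pose g i := (s^-1)%g (inord i) : nat.
  apply: (@swapped_of_bij _ x0 _ _ f g).
  - by rewrite size_map -cardE card_ord.
  - by move=> i li; rewrite /f /g !inord_val permKV permK inordK.
  - move=> i li; have := near (inord i); rewrite inordK // /f.
    by lia.
  - by move=> i li; rewrite -[i in LHS](inordK li) nthw.
have [f [fK fs near val]] := swapped_involution x0 H.
pose h (i : 'I_(size w)) := Ordinal (fs i (ltn_ord i)).
have hK : involutive h by move=> i; apply: val_inj; apply: fK.
exists (perm (inv_inj hK)) => [i|].
  by rewrite permE /=; case: (near i); move: (f i) (nat_of_ord i) => j k; lia.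
apply: (@eq_from_nth _ x0).
  by rewrite -(swapped_size H) size_map -cardE card_ord.
move=> i; rewrite -(swapped_size H) => li.
by rewrite (nthw _ (Ordinal li)) permE /= val.
Qed.

Section Detecting.
Variable q : nat.
Implicit Types u v c z x y : word q.

Lemma swapped_same_length_test u v c z :
  size u = size v -> swapped (u ++ c) (v ++ z) -> ~ same_length_test u v.
Proof.
move=> suv /(swapped_take (size u)); rewrite take_size_cat // => -[w uw wz].
apply; exists w; first exact/swap_ballP.
by rewrite wz suv takel_cat // leq_pred.
Qed.

Lemma swapped_two_stage_test (P : set (word q)) x y c z :
  (size x < size y)%N -> kstar P c -> swapped (x ++ c) (y ++ z) ->
  ~ two_stage_test P x y.
Proof.
move=> ltxy Pc H; case=> [S1|S2].
  have sy : size (take (size x) y) = size x by rewrite size_takel // ltnW.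
  (* Cut [y] at [size x] and count its remainder as part of the tail. *)
  apply: (@swapped_same_length_test x (take (size x) y) c
            (drop (size x) y ++ z)) => //; first by rewrite catA cat_take_drop.
  by rewrite /same_length_test sy.
have le_d : (size y - size x <= size c)%N.
  by have := swapped_size H; rewrite !size_cat; lia.
(* Here [rho] consists of the letters of [c] that follow [x] up to length [size y]; [le_d] ensures
   that [c] has enough of them. *)
apply: (@swapped_same_length_test (x ++ take (size y - size x) c) y
          (drop (size y - size x) c) z).
- by rewrite size_cat size_takel // subnKC // ltnW.
- by rewrite -catA cat_take_drop.
- by apply: S2; exists c.
Qed.

Variable P : set (word q).
Hypothesis DC1 : forall u v, P u -> P v -> u <> v -> size u = size v ->
  same_length_test u v.
Hypothesis DC2 : forall x y, P x -> P y -> (size x < size y)%N ->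
  two_stage_test P x y.

Lemma swapped_first_block x y c z : P x -> P y -> kstar P c -> kstar P z ->
  swapped (x ++ c) (y ++ z) -> x = y.
Proof.
move=> Px Py Pc Pz H; case: (ltngtP (size x) (size y)) => sxy.
- by case: (swapped_two_stage_test sxy Pc H); apply: DC2.
- by case: (swapped_two_stage_test sxy Pz (swapped_sym H)); apply: DC2.
- have [//|/eqP xy] := eqVneq x y.
  by case: (swapped_same_length_test sxy H); apply: DC1.
Qed.

Lemma swapped_kstar_eq c z : kstar P c -> kstar P z -> swapped c z -> c = z.
Proof.
move=> [ps Pps ->] [rs Prs ->] {c z}.
elim: ps rs Pps Prs => [|x ps IH] [|y rs] Pps Prs H //=.
- exact/esym/size0nil/esym/(swapped_size H).
- exact/size0nil/(swapped_size H).
have Pps' p : p \in ps -> P p by move=> pp; apply: Pps; rewrite inE pp orbT.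
have Prs' p : p \in rs -> P p by move=> pp; apply: Prs; rewrite inE pp orbT.
have xy : x = y.
  apply: (@swapped_first_block x y (flatten ps) (flatten rs)) => //.
  - by apply: Pps; rewrite mem_head.
  - by apply: Prs; rewrite mem_head.
  - by exists ps.
  - by exists rs.
by subst y; rewrite (IH rs) //; apply: swapped_cat H.
Qed.

End Detecting.

Theorem theorem17 (q : nat) (P : set (word q)) :
  (0 < q)%N ->
  finite_set P ->
  (forall p, P p -> p <> [::]) ->
  (forall u v, P u -> P v -> u <> v -> size u = size v ->
     same_length_test u v) ->
  (forall x y, P x -> P y -> (size x < size y)%N -> two_stage_test P x y) ->
  forall n : nat, detecting (code P n).
Proof.
move=> _ _ _ DC1 DC2 n c Cc; apply/seteqP; split=> z /=.
  move=> [/swap_ballP cz [Pz _]]; case: Cc => Pc _.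
  exact/esym/(swapped_kstar_eq DC1 DC2 Pc Pz cz).
by move=> ->; split=> //; apply/swap_ballP/swapped_refl.
Qed.
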